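(* Let $\mathbb{H}$ be a Hilbert space and let $T$ be a linear relation on $\mathbb{H}$. If $\operatorname{ran}(T\cap T^* )=\mathbb{H}$, then $T$ is self-adjoint, i.e. $T=T^*$.
   Context: A linear relation on $\mathbb{H}$ is a linear subspace $T$ of $\mathbb{H}\times\mathbb{H}$ (not assumed closed). Ordered pairs in $\mathbb{H}\times\mathbb{H}$ are written $\{f,f'\}$. The range of a linear relation $T$ is $\operatorname{ran}(T)=\{f'\in\mathbb{H}: \{f,f'\}\in T \text{ for some } f\in\mathbb{H}\}$. The adjoint of a linear relation $T$ is the linear relation $$T^*=\{\{f,f'\}\in\mathbb{H}\times\mathbb{H}: \langle f',h\rangle=\langle f,h'\rangle \text{ for all } \{h,h'\}\in T\}.$$ $T$ is called self-adjoint if $T=T^*$ (equality as subsets of $\mathbb{H}\times\mathbb{H}$). *)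

(* Defs.v *)
From HB Require Import structures.
From mathcomp Require Import all_boot all_order all_algebra.
From mathcomp Require Import all_classical all_reals all_analysis.
From mathcomp Require Import complex.

Set Implicit Arguments.
Unset Strict Implicit.
Unset Printing Implicit Defensive.

Import Order.TTheory GRing.Theory Num.Theory.
Import numFieldNormedType.Exports.

Local Open Scope classical_set_scope.
Local Open Scope ring_scope.

(* The inner product is linear in its first argument and [theta]-linear in the
   second; [theta] is [idfun] over the reals and [Num.conj] over the complex
   numbers. *)
HB.mixin Record CompleteNormedModule_isHilbert
    (K : numFieldType) (theta : K -> K) H of CompleteNormedModule K H := {
  inner : {dot H for theta} ;
  inner_norm : forall x : H, inner x x = `|x| ^+ 2 }.

#[short(type="hilbertType")]
HB.structure Definition Hilbert (K : numFieldType) (theta : K -> K) :=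
  { H of CompleteNormedModule_isHilbert K theta H & CompleteNormedModule K H }.

Notation realHilbertType R := (@hilbertType R idfun).
Notation complexHilbertType R := (@hilbertType R[i] Num.conj).

Section LinearRelation.
Context {K : numFieldType} {theta : K -> K} {H : hilbertType theta}.
Implicit Types T : set (H * H).

Definition linear_relation T := submod_closed [in T].

Definition ran T : set H := [set f' | exists f, T (f, f')].

Definition adjoint T : set (H * H) :=
  [set p | forall q, T q -> inner p.2 q.1 = inner p.1 q.2].

Definition self_adjoint T := T = adjoint T.

End LinearRelation.

(* Main.v *)
(* Put S = T `&` adjoint T. Given {f, f'} in T or in adjoint T, surjectivity of S
   gives {g, f'} in S, so {f - g, 0} lies in T, resp. in adjoint T. Pairing it
   with an element {h, f - g} of S shows that f - g is orthogonal to itself,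
   hence {f, f'} = {g, f'} is in S. *)
Require Import Defs.
From mathcomp Require Import all_boot all_order all_algebra.
From mathcomp Require Import all_classical all_reals all_analysis.
From mathcomp Require Import complex.

Local Open Scope classical_set_scope.
Local Open Scope ring_scope.

Import GRing.Theory Num.Theory.

Lemma inner_eq0 {K : numFieldType} {theta : K -> K} {H : hilbertType theta}
  (x : H) : inner x x = 0 -> x = 0.
Proof. by rewrite inner_norm => /eqP; rewrite sqrf_eq0 normr_eq0 => /eqP. Qed.

Lemma linear_relationB {K : numFieldType} {theta : K -> K}
    {H : hilbertType theta} (T : set (H * H)) (p q : H * H) :
  linear_relation T -> T p -> T q -> T (p - q).
Proof.
move=> /GRing.submod_closedB[_ subT] Tp Tq.
by have := subT p q; rewrite !inE; apply.
Qed.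

(** Generic in [theta], so that the real and complex cases are both instances. *)
Lemma self_adjoint_ran {K : numFieldType} {theta : K -> K}
    {H : hilbertType theta} (T : set (H * H)) :
  linear_relation T -> ran (T `&` adjoint T) = setT -> self_adjoint T.
Proof.
move=> linT ranS.
have ranSP f' : exists g, T (g, f') /\ adjoint T (g, f').
  by have : [set: H] f' by []; rewrite -ranS.
apply/seteqP; split=> -[f f'] Tf.
  have [g [Tg Sg]] := ranSP f'.
  have [h [_ Sh]] := ranSP (f - g).
  (* The difference [(f - g, 0)] is in [T]; testing [(h, f - g)] against it gives
     [inner (f - g) (f - g) = inner h 0]. *)
  have /Sh /= := linear_relationB _ _ _ linT Tf Tg.
  by rewrite subrr linear0r => /inner_eq0 /subr0_eq ->.
have [g [Tg Sg]] := ranSP f'.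
have [h [Th _]] := ranSP (f - g).
(* Here [Tf] says that [(f, f')] is in [adjoint T]. Tested against [(h, f - g)], both [(f, f')] and
   [(g, f')] give [inner f' h], so [f] and [g] have equal products with [f - g]. *)
have /= := Tf _ Th; rewrite (Sg _ Th) /= => /esym/eqP.
by rewrite -subr_eq0 -linearBl => /eqP /inner_eq0 /subr0_eq ->.
Qed.

Theorem theorem3p14 (R : realType) :
  (forall (H : realHilbertType R) (T : set (H * H)),
     linear_relation T -> ran (T `&` adjoint T) = setT -> self_adjoint T) /\
  (forall (H : complexHilbertType R) (T : set (H * H)),
     linear_relation T -> ran (T `&` adjoint T) = setT -> self_adjoint T).
Proof. by split=> H T; apply: self_adjoint_ran. Qed.
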